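(* Let $d$ be a positive integer and $0\le k\le n$ integers. Then $$\left\langle \begin{matrix} n\\ k\end{matrix}\right\rangle_{d,F}=\frac{\det\left(\binom{n+i+j}{k+j}_F\right)_{i,j=0}^{d-1}}{\det\left(\binom{n+i+j}{j}_F\right)_{i,j=0}^{d-1}}.$$
   Context: $F_n$ are the Fibonacci numbers ($F_0=0$, $F_1=1$, $F_n=F_{n-1}+F_{n-2}$). Fibonomial coefficients: $\binom{m}{k}_F=\prod_{j=0}^{k-1}\frac{F_{m-j}}{F_{k-j}}$ for $0\le k\le m$, and $0$ if $k<0$ or $k>m$. Fibo-Hoggatt numbers: $\langle m\rangle_{d,F}=\binom{m+d-1}{d}_F$ and, for $0\le k\le n$, $\left\langle \begin{matrix} n\\ k\end{matrix}\right\rangle_{d,F}=\prod_{j=0}^{k-1}\frac{\langle n-j\rangle_{d,F}}{\langle k-j\rangle_{d,F}}$.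
   Formalization: The case n = 0, d = 2 is excluded: there k = 0 and both determinants vanish, so the right-hand side is the undefined 0/0 while the left-hand side is 1. *)

(* Defs.v *)
From mathcomp Require Import all_boot all_order all_algebra.

Set Implicit Arguments.
Unset Strict Implicit.
Unset Printing Implicit Defensive.

Import GRing.Theory.
Local Open Scope ring_scope.

Fixpoint fib (n : nat) : nat :=
  if n is m.+1 then (if m is p.+1 then fib m + fib p else 1)%N else 0%N.

(* For [k <= m] none of the truncated subtractions underflows, and every
   denominator [fib (k - j)] is nonzero, since [j < k]. *)
Definition fibonomial (m k : nat) : rat :=
  if (k <= m)%N
  then \prod_(j < k) ((fib (m - j))%:R / (fib (k - j))%:R)
  else 0.

(* Only meaningful for [0 < d]: at [d = m = 0] the index [m + d - 1] is
   truncated. *)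
Definition fibo_hoggatt (d m : nat) : rat := fibonomial (m + d - 1) d.

(* Only meaningful for [k <= n]. For [0 < d] the factors
   [fibo_hoggatt d (k - j)] are then nonzero. *)
Definition fibo_hoggatt_coef (d n k : nat) : rat :=
  \prod_(j < k) (fibo_hoggatt d (n - j) / fibo_hoggatt d (k - j)).

(* Main.v *)
(** Write [n]! for the product of the first n Fibonacci numbers. Pulling
    1/[k+j]! out of the columns and 1/[n-k+i]! out of the rows turns both
    determinants into the same Hankel determinant det([n+i+j]!), so the ratio
    is an explicit product, provided that this determinant does not vanish;
    equivalently, the matrix of the fibonomials of (n+i+j, j) is nonsingular.

    For d > 2 this holds modulo a suitable prime p dividing F_d. Let r be the
    rank of p (the least r > 0 with p | F_r), so that d = D r, and let
    c = F_(r+1) modulo p. By an analogue of Lucas' theorem, for y, s < r,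
      (r(x+a)+y+s, r a+s)_F = C(x+a, a) c^(r x a + x s + a y) (y+s, s)_F
    and (y+s, s)_F vanishes for y + s >= r. So the matrix is block
    antitriangular modulo p, with diagonal blocks C(x+a, a) (c^r)^(x a) up to
    units, and these are invertible if D = 1 or c^r = 1.

    If d is even, take p dividing the Lucas number F_d / F_(d/2): its rank is
    even (or p = 2), hence c^2 = 1 by Cassini's identity; if 3 | d, take p = 2.
    If d is coprime to 6, take a primitive prime divisor of F_d, so D = 1: were
    there none, F_d would divide d lcm_(q | d) F_(d/q), which is too small by
    inclusion-exclusion over the primes q dividing d. *)

Require Import Defs.
From mathcomp Require Import all_boot all_order all_algebra.
From mathcomp Require Import zify ring.

Import GRing.Theory.
Local Open Scope nat_scope.

(** * Addition formula, Cassini's identity and gcds of Fibonacci numbers *)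

Lemma fibSS n : fib n.+2 = fib n.+1 + fib n.
Proof. by []. Qed.

Lemma fib_add m n :
  fib (m + n).+1 = fib m.+1 * fib n.+1 + fib m * fib n.
Proof.
elim: m n => [|m IH] n; first by rewrite mul1n mul0n addn0.
rewrite addSnnS IH !fibSS; ring.
Qed.

Lemma fib_gt0 n : 0 < n -> 0 < fib n.
Proof.
case: n => // n _; elim: n => // n IH; rewrite fibSS; exact: ltn_addr.
Qed.

Lemma leq_fibS n : fib n <= fib n.+1.
Proof. by case: n => // n; rewrite fibSS leq_addr. Qed.

Lemma leq_fib : {homo fib : m n / m <= n}.
Proof. by apply: homo_leq => [//|? ? ?|]; [exact: leq_trans | exact: leq_fibS]. Qed.

Lemma coprime_fibS n : coprime (fib n) (fib n.+1).
Proof.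
elim: n => // n IH; rewrite fibSS /coprime gcdnDl gcdnC; exact: IH.
Qed.

(** The sign (-1)^n is split between the two sides to stay in [nat]. *)
Lemma fib_cassini n :
  fib n.+1 ^ 2 + odd n = fib n * fib n.+1 + fib n ^ 2 + ~~ odd n.
Proof.
elim: n => // n IH; move: IH; rewrite fibSS /=; case: (odd n) => /=; nia.
Qed.

Lemma gcdn_fib_add m n : gcdn (fib m) (fib (m + n)) = gcdn (fib m) (fib n).
Proof.
case: n => [|n]; first by rewrite addn0 gcdn0 gcdnn.
rewrite addnS fib_add addnC [fib m * _]mulnC gcdnMDl Gauss_gcdr //.
exact: coprime_fibS.
Qed.

Lemma gcdn_fib m n : gcdn (fib m) (fib n) = fib (gcdn m n).
Proof.
have [k] := ubnP (m + n); elim: k m n => // k IH m n lt_k.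
wlog le_mn : m n lt_k / m <= n.
  move=> W; case/orP: (leq_total m n) => le_mn; first exact: W.
  by rewrite gcdnC W 1?gcdnC // addnC.
case: m => [|m] in lt_k le_mn *; first by rewrite !gcd0n.
rewrite -(subnKC le_mn) gcdn_fib_add gcdnDl IH //; lia.
Qed.

Lemma dvdn_fib m n : m %| n -> fib m %| fib n.
Proof.
by move/gcdn_idPl => mn; apply/gcdn_idPl; rewrite gcdn_fib mn.
Qed.

(** * Fibonacci factorials and fibonomials as natural numbers *)

Definition fibfact n := \prod_(i < n) fib i.+1.

Lemma fibfactS n : fibfact n.+1 = fibfact n * fib n.+1.
Proof. by rewrite /fibfact big_ord_recr. Qed.

Lemma fibfact_gt0 n : 0 < fibfact n.
Proof. by apply: prodn_gt0 => i; apply: fib_gt0. Qed.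

(* The recursion comes from
   [F_(m+1) = F_(m-k+1) F_(k+1) + F_(m-k) F_k], which needs no subtraction. *)
Fixpoint fibbin (m k : nat) : nat :=
  match m, k with
  | _, 0 => 1
  | 0, _.+1 => 0
  | m'.+1, k'.+1 => fib (m' - k').+1 * fibbin m' k' + fib k' * fibbin m' k
  end.

Lemma fibbinSS m k :
  fibbin m.+1 k.+1 = fib (m - k).+1 * fibbin m k + fib k * fibbin m k.+1.
Proof. by []. Qed.

Lemma fibbin0 m : fibbin m 0 = 1.
Proof. by case: m. Qed.

Lemma fibbin_small m k : m < k -> fibbin m k = 0.
Proof.
elim: m k => [|m IH] [|k] //= lt_mk.
by rewrite !IH ?muln0 //; lia.
Qed.

Lemma fibbin_fact m k :
  fibbin (m + k) k * (fibfact k * fibfact m) = fibfact (m + k).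
Proof.
have [N] := ubnP (m + k); elim: N m k => // N IH [|m] [|k] lt_N.
- by rewrite fibbin0 /fibfact !big_ord0.
- rewrite add0n /= subnn (@fibbin_small k k.+1) // muln0 addn0 mul1n.
  have E := IH 0 k ltac:(lia); rewrite !add0n in E.
  by rewrite fibfactS -[in RHS]E; ring.
- by rewrite addn0 fibbin0 mul1n /fibfact big_ord0 mul1n.
rewrite addnS [in RHS]fibfactS.
rewrite fibbinSS.
have E1 : fibbin (m.+1 + k) k * (fibfact k * fibfact m.+1) = fibfact (m.+1 + k).
  by apply: IH; lia.
have E2 : fibbin (m.+1 + k) k.+1 * (fibfact k.+1 * fibfact m) = fibfact (m.+1 + k).
  by rewrite addSnnS; apply: IH; lia.
by rewrite fib_add addnK mulnDr -{1}E1 -E2 !fibfactS; ring.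
Qed.

Lemma fibbin_sym m k : fibbin (m + k) k = fibbin (m + k) m.
Proof.
have := fibbin_fact k m; rewrite addnC -fibbin_fact [fibfact k * _]mulnC => /eqP.
by rewrite eqn_pmul2r ?muln_gt0 ?fibfact_gt0 // => /eqP.
Qed.

Lemma fibbinn n : fibbin n n = 1.
Proof. by rewrite -[n in fibbin n]add0n fibbin_sym fibbin0. Qed.

Lemma fibbin_rec m k :
  fibbin (m.+1 + k.+1) k.+1 =
    fib m.+2 * fibbin (m.+1 + k) k + fib k * fibbin (m + k.+1) k.+1.
Proof.
by rewrite addnS fibbinSS addnK addSnnS.
Qed.

Local Open Scope ring_scope.

(** * Lucas' theorem for fibonomials *)

Lemma fib_mulDr_char (K : comNzRingType) (r x y : nat) :
  (fib r)%:R = 0 :> K ->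
  (fib (r * x + y))%:R = (fib r.+1)%:R ^+ x * (fib y)%:R :> K.
Proof.
move=> r0; elim: x y => [|x IH] y; first by rewrite muln0 expr0 mul1r.
have fib_rD z : (fib (r + z))%:R = (fib r.+1)%:R * (fib z)%:R :> K.
  case: z => [|z]; first by rewrite addn0 r0 mulr0.
  by rewrite addnS fib_add natrD !natrM r0 mul0r addr0.
by rewrite mulnS -addnA fib_rD IH exprS mulrA.
Qed.

(** Double induction along [fibbin_rec]. The cases y = 0 and s = 0 are those where lowering m or j
    borrows from the quotient by r. If both borrow, Pascal's rule for C(x+a, a) appears; if exactly
    one does, one of the two terms vanishes; if none does, the recurrence acts on the residues
    alone. *)
Lemma fibbin_lucas (K : comNzRingType) (r : nat) (c := (fib r.+1)%:R : K) :
  (0 < r)%N -> (fib r)%:R = 0 :> K ->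
  (forall y s, (y < r)%N -> (s < r)%N -> (r <= y + s)%N ->
     (fibbin (y + s) s)%:R = 0 :> K) ->
  forall m j x y a s, m = (r * x + y)%N -> j = (r * a + s)%N ->
  (y < r)%N -> (s < r)%N ->
  (fibbin (m + j) j)%:R =
    'C(x + a, a)%:R * c ^+ (r * x * a + x * s + a * y) *
    (fibbin (y + s) s)%:R :> K.
Proof.
move=> r_gt0 r0 van.
have fib_r1 : (fib r.-1)%:R = c.
  by case: r r_gt0 r0 @c {van} => // r _ r0 c; rewrite /c fibSS natrD r0 add0r.
elim=> [|m IHm] j x y a s.
  move=> /esym/eqP; rewrite addn_eq0 muln_eq0 (gtn_eqF r_gt0) => /andP[/eqP-> /eqP->] -> _ _.
  rewrite !(muln0, mul0n, addn0, add0n) binn expr0 !mul1r.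
  by rewrite !fibbinn.
elim: j x y a s => [|j IHj] x y a s Em.
  move=> /esym/eqP; rewrite addn_eq0 muln_eq0 (gtn_eqF r_gt0) => /andP[/eqP-> /eqP->] _ _.
  by rewrite !(muln0, mul0n, addn0, add0n) bin0 expr0 !fibbin0 !mul1r.
move=> Ej lt_y lt_s; rewrite fibbin_rec natrD !natrM.
have -> : (fib m.+2)%:R = c ^+ x * (fib y.+1)%:R.
  by rewrite -fib_mulDr_char // addnS -Em.
case: s lt_s Ej => [|s] lt_s Ej.
  case: a Ej => [|a] Ej; first by lia.
  have {}Ej : j = (r * a + r.-1)%N by nia.
  have -> : (fib j)%:R = c ^+ a.+1 by rewrite Ej fib_mulDr_char // fib_r1 exprSr.
  rewrite (IHj x y a r.-1) //; last by lia.
  case: y lt_y Em => [|y] lt_y Em.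
    case: x Em => [|x] Em; first by lia.
    have {}Em : m = (r * x + r.-1)%N by nia.
    rewrite (IHm j.+1 x r.-1 a.+1 0%N) //; [|nia|lia].
    rewrite !add0n !addn0 fibbin0 fibbinn !mulr1.
    have -> : (x.+1 + a.+1 = (x.+1 + a).+1)%N by lia.
    rewrite binS [in RHS]natrD -addSnnS.
    rewrite mulrDl [in RHS]addrC; congr (_ + _).
      rewrite mulrCA -exprD; congr (_ * _ ^+ _); nia.
    rewrite mulrCA -exprD; congr (_ * _ ^+ _); nia.
  rewrite (van y.+1 r.-1) //; [|lia..]; rewrite !mulr0 add0r.
  rewrite (IHm j.+1 x y a.+1 0%N) //; [|nia..].
  rewrite !fibbin0 !mulr1 mulrCA -exprD; congr (_ * _ ^+ _); nia.
have {}Ej : j = (r * a + s)%N by nia.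
rewrite (IHj x y a s) //; last by lia.
case: y lt_y Em => [|y] lt_y Em.
  case: x Em => [|x] Em; first by lia.
  have {}Em : m = (r * x + r.-1)%N by nia.
  rewrite (IHm j.+1 x r.-1 a s.+1) //; [|nia|lia].
  rewrite (van r.-1 s.+1) //; [|lia..]; rewrite !mulr0 addr0.
  rewrite !add0n !fibbinn !mulr1 mulrCA -exprD; congr (_ * _ ^+ _); nia.
have -> : (fib j)%:R = c ^+ a * (fib s)%:R by rewrite Ej fib_mulDr_char.
rewrite (IHm j.+1 x y a s.+1) //; [|nia..].
rewrite [fibbin (y.+1 + s.+1) _]fibbin_rec natrD !natrM.
set e1 := (r * x * a + x * s + a * y.+1)%N.
set e2 := (r * x * a + x * s.+1 + a * y)%N.
have -> : (r * x * a + x * s.+1 + a * y.+1 = x + e1)%N by rewrite /e1; lia.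
(* Both terms carry the same power of c, which factors out of the recurrence for (y+s, s)_F. *)
have E : (x + e1 = a + e2)%N by rewrite /e1 /e2; lia.
rewrite [RHS]mulrDr {2}E !exprD; ring.
Qed.

(** * Nonsingularity modulo p *)

(** By Pascal's rule, differences of consecutive equations form the same system of size D-1 in the
    unknowns w (a+1), with X+1 for X. Nothing is divided, so the characteristic does not matter. *)
Lemma binomial_nonsingular (K : nzRingType) (D X : nat) (w : nat -> K) :
  (forall k, (k < D)%N -> \sum_(a < D) 'C(X + k + a, a)%:R * w a = 0) ->
  forall a, (a < D)%N -> w a = 0.
Proof.
elim: D X w => [|D IH] X w Hw; first by [].
have w_S : forall a, (a < D)%N -> w a.+1 = 0.
  apply: (IH X.+1 (fun a => w a.+1)) => k lt_k.
  have /eqP := etrans (Hw k.+1 lt_k) (esym (Hw k (ltnW lt_k))).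
  rewrite -subr_eq0 -sumrB big_ord_recl !bin0 subrr add0r => /eqP E.
  rewrite -[RHS]E; apply: eq_bigr => a _; rewrite -mulrBl lift0 addnS addnS.
  by rewrite !addnS binS natrD [X in X - _]addrC addrK.
case=> [|a] lt_a; last exact: w_S.
have := Hw 0%N isT; rewrite big_ord_recl bin0 mul1r big1 ?addr0 // => a _.
by rewrite lift0 w_S ?mulr0.
Qed.

Definition fib_rank (p r : nat) : Prop :=
  [/\ (0 < r)%N, (p %| fib r)%N &
      forall m, (0 < m)%N -> (m < r)%N -> ~~ (p %| fib m)%N].

Lemma fib_rank_ndvd_fibfact p r m :
  prime p -> fib_rank p r -> (m < r)%N -> ~~ (p %| fibfact m)%N.
Proof.
move=> p_pr [_ _ r_min]; elim: m => [|m IH] lt_m.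
  by rewrite /fibfact big_ord0 dvdn1; case: eqP p_pr => // ->.
by rewrite fibfactS Euclid_dvdM // negb_or IH ?(ltnW lt_m) ?r_min.
Qed.

Lemma fib_rank_dvd_fibfact p r m :
  fib_rank p r -> (r <= m)%N -> (p %| fibfact m)%N.
Proof.
move=> [r_gt0 p_r _] /subnKC <-; elim: (m - r)%N => [|k IH].
  by rewrite addn0 -(prednK r_gt0) fibfactS dvdn_mull // prednK.
by rewrite addnS fibfactS dvdn_mulr.
Qed.

(** Strong induction on the residue s of the column index modulo r. In the rows with n + i congruent
    to y = r-1-s, columns of residue above s vanish because of a carry and those below s are
    settled, which leaves a binomial system for the columns of residue s. *)
Lemma fibbin_nonsingular (K : fieldType) (p r D n : nat) (v : nat -> K) :
  p \in [pchar K] -> fib_rank p r ->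
  (D = 1)%N \/ (fib r.+1)%:R ^+ r = 1 :> K ->
  (forall i, (i < D * r)%N ->
     \sum_(j < D * r) (fibbin (n + i + j) j)%:R * v j = 0) ->
  forall j, (j < D * r)%N -> v j = 0.
Proof.
move=> pK rk hD Hv; have p_pr := pcharf_prime pK.
have [r_gt0 p_r r_min] := rk.
have r0 : (fib r)%:R = 0 :> K by apply/eqP; rewrite -(dvdn_pcharf pK).
set c : K := (fib r.+1)%:R in hD.
have c_neq0 : c != 0.
  rewrite /c -(dvdn_pcharf pK); apply/negP => p_r1.
  have := dvdn_gcd p (fib r) (fib r.+1); rewrite p_r p_r1.
  by rewrite (eqP (coprime_fibS r)) dvdn1; case: eqP p_pr => // ->.
have van y s : (y < r)%N -> (s < r)%N -> (r <= y + s)%N ->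
    (fibbin (y + s) s)%:R = 0 :> K.
  move=> lt_y lt_s le_r; apply/eqP; rewrite -(dvdn_pcharf pK).
  have := fib_rank_dvd_fibfact p r _ rk le_r; rewrite -fibbin_fact.
  rewrite !Euclid_dvdM // !(negPf (fib_rank_ndvd_fibfact p r _ p_pr rk _)) //.
  by rewrite !orbF.
have key s : (s < r)%N -> forall a, (a < D)%N -> v (a * r + s)%N = 0.
  elim/ltn_ind: s => s IHs lt_s.
  pose y := (r.-1 - s)%N; have lt_y : (y < r)%N by rewrite /y; lia.
  have T0 : (fibbin (y + s) s)%:R != 0 :> K.
    rewrite -(dvdn_pcharf pK); apply: contra (dvdn_mulr (fibfact s * fibfact y)) _.
    by rewrite fibbin_fact (fib_rank_ndvd_fibfact p r) // /y; lia.
  (* The least X with n <= r X + y, so that the D rows r (X+k) + y - n with k < D all exist. *)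
  pose X := ((n + r.-1 - y) %/ r)%N.
  have eqs k : (k < D)%N ->
      \sum_(a < D) 'C(X + k + a, a)%:R *
        (c ^+ (r * (X + k) * a) * (c ^+ (a * y) * v (a * r + s)%N)) = 0.
    move=> lt_k.
    have Xn : (n <= r * (X + k) + y < n + D * r)%N.
      have := divn_eq (n + r.-1 - y) r; rewrite -/X.
      have := ltn_pmod (n + r.-1 - y) r_gt0; nia.
    have lt_i : (r * (X + k) + y - n < D * r)%N by lia.
    have := Hv _ lt_i; rewrite subnKC; last by case/andP: Xn.
    rewrite -(big_mkord xpredT
      (fun j => (fibbin (r * (X + k) + y + j) j)%:R * v j)) big_nat_mul big_mkord.
    move=> E.
    have : c ^+ ((X + k) * s) * (fibbin (y + s) s)%:R * (\sum_(a < D) 'C(X + k + a, a)%:R *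
        (c ^+ (r * (X + k) * a) * (c ^+ (a * y) * v (a * r + s)%N))) = 0.
      rewrite -[RHS]E mulr_sumr; apply: eq_bigr => a _.
      rewrite -[in RHS](add0n (a * r)%N) big_addn mulSn addnK big_mkord.
      rewrite (bigD1 (Ordinal lt_s)) //= big1 ?addr0; last first.
        move=> s' ns'; have lt_s' := ltn_ord s'.
        case: (ltnP s' s) => [lt_ss'|le_ss'].
          by rewrite [(s' + _)%N]addnC IHs ?mulr0.
        rewrite (fibbin_lucas _ r _ _ van _ _ (X + k) y a s') //; last by rewrite mulnC addnC.
        have lt_ss' : (s < s')%N.
          by rewrite ltn_neqAle le_ss' andbT; apply: contraNneq ns' => E'; apply/eqP/val_inj.
        rewrite (van y s') ?mulr0 ?mul0r // /y; move: (nat_of_ord s') lt_ss'; lia.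
      rewrite (fibbin_lucas _ r _ _ van (r * (X + k) + y) (s + a * r) (X + k) y a s) //; last by rewrite mulnC addnC.
      rewrite -/c [(s + a * r)%N]addnC !exprD; ring.
    move/eqP; rewrite !mulf_eq0 expf_eq0 (negPf c_neq0) andbF (negPf T0) /=.
    by move/eqP.
  have w0 a : (a < D)%N -> c ^+ (a * y) * v (a * r + s)%N = 0.
    (* The power of c depending on k is 1: either c^r = 1, or D = 1 leaves only a = 0. *)
    case: hD => [D1 | t1]; last first.
      apply: (binomial_nonsingular _ D X (fun a => c ^+ (a * y) * v (a * r + s)%N)).
      move=> k lt_k; rewrite -[RHS](eqs k lt_k); apply: eq_bigr => b _.
      by rewrite -mulnA [c ^+ (r * _)]exprM t1 expr1n mul1r.
    move: eqs; rewrite D1 => /(_ 0%N isT); rewrite big_ord1 muln0 bin0 !mul1r.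
    by move=> E; case: a => // _; rewrite mul1r.
  move=> a lt_a; move/eqP: (w0 a lt_a); rewrite mulf_eq0 expf_eq0 (negPf c_neq0) andbF /=.
  by move/eqP.
move=> j lt_j; rewrite (divn_eq j r) key ?ltn_pmod // ltn_divLR //.
Qed.

Lemma det_fibbin_neq0 (K : fieldType) (p r D n : nat) :
  p \in [pchar K] -> fib_rank p r ->
  (D = 1)%N \/ (fib r.+1)%:R ^+ r = 1 :> K ->
  \det (\matrix_(i < D * r, j < D * r) (fibbin (n + i + j) j)%:R) != 0 :> K.
Proof.
move=> pK rk hD; rewrite -det_tr; apply/det0P => -[v v_neq0 Hv].
case/eqP: v_neq0; apply/rowP => j; rewrite mxE.
(* The kernel vector, extended by 0 beyond its length. *)
pose w k := if insub k is Some j' then v 0 j' else 0.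
have wE (i : 'I_(D * r)) : w i = v 0 i by rewrite /w valK.
rewrite -wE; apply: (fibbin_nonsingular _ p r D n w) => // i lt_i.
move/rowP/(_ (Ordinal lt_i)): Hv; rewrite !mxE => E; rewrite -[RHS]E.
by apply: eq_bigr => k _; rewrite !mxE wE mulrC.
Qed.

Local Open Scope nat_scope.

(** * Ranks, and a suitable prime for even d *)

(** For the least r, p divides F_(gcd(r, d)) as well, so minimality gives gcd(r, d) = r. *)
Lemma fib_rank_ex p d :
  0 < d -> p %| fib d -> exists2 r, fib_rank p r & r %| d.
Proof.
move=> d_gt0 p_d.
have ex : exists m, (0 < m) && (p %| fib m) by exists d; rewrite d_gt0.
case: (ex_minnP ex) => r /andP[r_gt0 p_r] r_min.
have rk : fib_rank p r.
  split=> // m m_gt0 lt_m; apply/negP => p_m.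
  by have := r_min m; rewrite m_gt0 p_m leqNgt lt_m => /(_ isT).
exists r => //; apply/gcdn_idPl/eqP; rewrite eqn_leq dvdn_leq ?dvdn_gcdl //.
by rewrite r_min // gcdn_gt0 r_gt0 -gcdn_fib dvdn_gcd p_r.
Qed.

Lemma fib_double e : fib e.+1.*2 = fib e.+1 * (fib e + fib e.+2).
Proof. by rewrite -addnn addnS fib_add; ring. Qed.

(** Let p divide L = F_(e-1) + F_(e+1), which exceeds 1 as e > 1. If p is odd, an odd rank would
    divide e, so p would divide F_e and L + F_e = 2 F_(e+1), against coprimality of F_e and F_(e+1).
    If p = 2, then r = 3 and F_4^3 = 27 is odd. *)
Lemma even_rank_prime e : 1 < e ->
  exists p r, [/\ prime p, fib_rank p r, r %| e.*2 & fib r.+1 ^ r = 1 %[mod p]].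
Proof.
case: e => [|e] // e_gt1.
have L_gt1 : 1 < fib e + fib e.+2.
  by rewrite fibSS; case: e e_gt1 => // e _; have := fib_gt0 e.+1; have := fib_gt0 e.+2; lia.
pose p := pdiv (fib e + fib e.+2); have p_pr : prime p := pdiv_prime L_gt1.
have p_L : p %| fib e + fib e.+2 := pdiv_dvd _.
have p_d : p %| fib e.+1.*2 by rewrite fib_double dvdn_mull.
have [r rk r_d] := fib_rank_ex p e.+1.*2 isT p_d; have [r_gt0 p_r r_min] := rk.
exists p, r; split=> //.
have [p2 | p_odd] := even_prime p_pr.
  have r3 : r = 3.
    have : r <= 3 by rewrite leqNgt; apply/negP => /(r_min 3 isT); rewrite p2.
    by case: r r_gt0 p_r {rk r_d r_min} => [|[|[|[|?]]]] //; rewrite p2.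
  by rewrite r3 p2.
have r_even : ~~ odd r.
  apply/negP => r_odd.
  have r_e : r %| e.+1.
    by move: r_d; rewrite -muln2 Gauss_dvdl // coprimen2.
  have p_e : p %| fib e.+1 by apply: dvdn_trans p_r (dvdn_fib _ _ r_e).
  have : p %| fib e.+2 + fib e.+2.
    have -> : fib e.+2 + fib e.+2 = fib e + fib e.+2 + fib e.+1 by rewrite {1}fibSS; lia.
    exact: dvdn_add.
  rewrite addnn -muln2 Euclid_dvdM // => /orP[p_e1|].
    have := dvdn_gcd p (fib e.+1) (fib e.+2); rewrite p_e p_e1.
    by rewrite (eqP (coprime_fibS _)) dvdn1; case: eqP p_pr => // ->.
  by move/dvdn_leq => /(_ isT); case: p p_pr p_odd {p_L p_d rk p_r r_min p_e} => [|[|[|?]]].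
have c2 : fib r.+1 ^ 2 = 1 %[mod p].
  have p_rr : p %| fib r * fib r.+1 + fib r ^ 2 by rewrite dvdn_add ?dvdn_mulr.
  have := fib_cassini r; rewrite (negPf r_even) addn0 => ->.
  by rewrite -modnDml (eqP p_rr).
rewrite -[X in _ ^ X](even_halfK r_even) -muln2 mulnC expnM.
by rewrite -modnXm c2 modnXm exp1n.
Qed.

(** * Lifting the exponent *)

(** If phi^2 = phi + 1, then phi^(e+1) = F phi + h; these are the first terms of the binomial
    expansion of its powers. At k = 0 the truncated exponent [k.-1] comes with coefficient 0. *)
Lemma fib_mul_expand e k (F := fib e.+1) (h := fib e) :
  exists b b',
    fib (k * e.+1).+1 = h ^ k + k * F * h ^ k.-1 + F ^ 2 * b /\
    fib (k.+1 * e.+1) =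
      F * (k.+1 * h ^ k + 'C(k.+1, 2) * F * h ^ k.-1 + F ^ 2 * b').
Proof.
elim: k => [|k [b [b' [E1 E2]]]].
  by exists 0, 0; rewrite mul1n !mul0n /= muln0 addn0 muln1.
have [c Ec] : exists c, fib (k * e.+1) = F * c.
  by have /dvdnP[c ->] : F %| fib (k * e.+1) by [apply: dvdn_fib; apply: dvdn_mull]; exists c; rewrite mulnC.
have E1' : exists b0, fib (k.+1 * e.+1).+1 = h ^ k.+1 + k.+1 * F * h ^ k + F ^ 2 * b0.
  exists (k * h ^ k.-1 + b * (F + h) + c).
  by rewrite mulSn addnC fib_add fibSS -/F -/h E1 Ec; case: (k) => [|j]; rewrite /= ?expnS ?expn0; ring.
have [b0 Eb0] := E1'; exists b0; exists (b0 + h * b'); split=> //.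
rewrite mulSn addSn fib_add -/F -/h Eb0 E2 /= [in RHS]binS bin1.
by case: (k) => [|j]; rewrite /= ?expnS ?expn0 ?(@bin_small 1 2) //; ring.
Qed.

(** Write F_(qe) = F_e a, with a = q h^(q-1) + C(q,2) F h^(q-2) + F^2 b, F = F_e, and h = F_(e-1)
    prime to p. If p differs from q, then p does not divide a. If p = q is odd, p divides C(q,2), so
    a is q h^(q-1) modulo p^2. *)
Lemma logn_fib_mul p q e :
  prime p -> prime q -> odd q -> 0 < e -> p %| fib e ->
  logn p (fib (q * e)) <= logn p (fib e) + logn p q.
Proof.
case: e => // e p_pr q_pr q_odd _ p_e.
have q_gt0 := prime_gt0 q_pr.
have [_ [b [_ E]]] := fib_mul_expand e q.-1; rewrite prednK // in E.
have p_h : coprime p (fib e).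
  rewrite prime_coprime //; apply/negP => p_h.
  have := dvdn_gcd p (fib e) (fib e.+1); rewrite p_h p_e.
  by rewrite (eqP (coprime_fibS e)) dvdn1; case: eqP p_pr => // ->.
move: E; set a := (_ + _ + _) => E.
have a_gt0 : 0 < a.
  have : 0 < fib (q * e.+1) by rewrite fib_gt0 // muln_gt0 q_gt0.
  by rewrite E muln_gt0 => /andP[].
rewrite E lognM ?fib_gt0 // leq_add2l.
have [pq | p_q] := eqVneq p q; last first.
  suff -> : logn p a = 0 by [].
  apply/eqP; rewrite -leqn0 leqNgt logn_gt0 mem_primes p_pr a_gt0 /=.
  rewrite /a -addnA dvdn_addl; last by rewrite dvdn_add // dvdn_mulr // ?dvdn_mull // dvdn_exp.
  by rewrite Euclid_dvdM // negb_or dvdn_prime2 // p_q -prime_coprime // coprimeXr.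
rewrite -pq (pfactorK 1 p_pr) leqNgt -pfactor_dvdn //.
rewrite /a -pq -addnA dvdn_addl; last first.
  rewrite dvdn_add //; last by rewrite dvdn_mulr // dvdn_exp2r.
  rewrite dvdn_mulr // expnS expn1 dvdn_mul // prime_dvd_bin // pq.
  by case: q q_pr q_odd {pq E a a_gt0 q_gt0} => [|[|[|?]]].
rewrite expnS expn1 dvdn_pmul2l ?prime_gt0 // -prime_coprime // coprimeXr //.
Qed.

Lemma dvdn_logn m n : 0 < m -> 0 < n ->
  (forall p, prime p -> p %| m -> logn p m <= logn p n) -> m %| n.
Proof.
move=> m_gt0 n_gt0 le_log; apply/dvdn_partP => // p.
rewrite mem_primes => /and3P[p_pr _ p_m].
by rewrite p_part pfactor_dvdn ?le_log.
Qed.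

(** * The lcm of the F_(m/q), and its size *)

Definition fib_lcm (l : seq nat) m := \big[lcmn/1]_(q <- l) fib (m %/ q).

Lemma fib_lcm_gt0 l m : 0 < m -> all (fun q => (0 < q) && (q %| m)) l -> 0 < fib_lcm l m.
Proof.
move=> m_gt0; rewrite /fib_lcm; elim: l => [|q l IH] /=; first by rewrite big_nil.
move=> /andP[/andP[q_gt0 q_m] l_ok]; rewrite big_cons lcmn_gt0 IH // andbT.
by rewrite fib_gt0 // divn_gt0 // dvdn_leq.
Qed.

Lemma dvdn_fib_lcm l m q : q \in l -> fib (m %/ q) %| fib_lcm l m.
Proof.
rewrite /fib_lcm; elim: l => // r l IH; rewrite inE big_cons => /orP[/eqP <-|/IH].
  exact: dvdn_lcml.
by move=> H; apply: dvdn_trans H (dvdn_lcmr _ _).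
Qed.

(* If [F_d] had no primitive prime divisor, each of its prime divisors would
   already divide some [F_(d/q)] with [q] prime, and passing from [d/q] to [d]
   raises its exponent by at most its exponent in [q]. *)
Lemma fib_dvd_lcm d : 0 < d -> odd d ->
  (forall p, prime p -> p %| fib d -> ~ fib_rank p d) ->
  fib d %| d * fib_lcm (primes d) d.
Proof.
move=> d_gt0 d_odd no_prim.
have A_gt0 : 0 < fib_lcm (primes d) d.
  apply: fib_lcm_gt0 => //; apply/allP => q; rewrite mem_primes => /and3P[q_pr _ ->].
  by rewrite prime_gt0.
apply: dvdn_logn; rewrite ?fib_gt0 ?muln_gt0 ?d_gt0 // => p p_pr p_d.
have [r rk r_d] := fib_rank_ex p d d_gt0 p_d.
have dr_gt1 : 1 < d %/ r.
  have := divnK r_d; case: (d %/ r) => [|[|?]] // E; first by rewrite -E in d_gt0.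
  by case: (no_prim p p_pr p_d); rewrite -E mul1n.
pose q := pdiv (d %/ r); have q_pr : prime q := pdiv_prime dr_gt1.
have q_dr : q * r %| d by rewrite -(divnK r_d) dvdn_mul // pdiv_dvd.
have q_d : q %| d by apply: dvdn_trans q_dr; apply: dvdn_mulr.
have p_dq : p %| fib (d %/ q).
  case: rk => _ p_r _; apply: dvdn_trans p_r _; apply: dvdn_fib.
  by rewrite dvdn_divRL // mulnC.
rewrite -[in leqLHS](divnK q_d) mulnC.
apply: leq_trans (logn_fib_mul p q _ p_pr q_pr _ _ p_dq) _.
- exact: dvdn_odd q_d d_odd.
- by rewrite divn_gt0 ?prime_gt0 // dvdn_leq.
rewrite lognM // addnC leq_add // dvdn_leq_log //.
by apply: dvdn_fib_lcm; rewrite mem_primes q_pr d_gt0.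
Qed.

Lemma fib_add_ge m n : fib m * fib n <= fib (m + n).
Proof.
case: m => [|m] //; rewrite addSn fib_add; apply: leq_trans (leq_addr _ _).
by rewrite leq_mul2l leq_fibS orbT.
Qed.

Lemma fib_add_le m n : 0 < m -> 0 < n -> fib (m + n) <= 3 * (fib m * fib n).
Proof.
case: m n => [|m] [|n] // _ _; rewrite addSn fib_add fibSS.
have := leq_fibS m; have := leq_fibS n; nia.
Qed.

(** The gcd distributes over the lcm, and gcd(m/q, m/r) = m/(qr) for distinct primes q, r dividing
    m. *)
Lemma gcdn_fib_lcm_cons q l m :
  prime q -> q %| m -> q \notin l -> all prime l -> all (fun r => r %| m) l ->
  0 < m ->
  gcdn (fib (m %/ q)) (fib_lcm l m) = fib_lcm l (m %/ q).
Proof.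
move=> q_pr q_m q_l l_pr l_m m_gt0; rewrite /fib_lcm.
elim: l q_l l_pr l_m => [|r l IH] /=; first by rewrite !big_nil gcdn1.
rewrite inE negb_or => /andP[q_r q_l] /andP[r_pr l_pr] /andP[r_m l_m].
rewrite !big_cons -IH // gcdnC Order.NatDvd.meetUl gcdnC [gcdn (\big[_/_]_(_ <- _) _) _]gcdnC.
congr (lcmn _ _); rewrite gcdn_fib; congr fib.
have cqr : coprime q r by rewrite prime_coprime // dvdn_prime2.
have /dvdnP[N EN] : q * r %| m by rewrite Gauss_dvd // q_m.
have q_gt0 := prime_gt0 q_pr; have r_gt0 := prime_gt0 r_pr.
have -> : m %/ q = N * r by rewrite EN mulnCA mulKn.
have -> : m %/ r = N * q by rewrite EN mulnA mulnK.
by rewrite -muln_gcdr gcdnC (eqP cqr) muln1 mulnK.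
Qed.

(* Inclusion-exclusion, one prime at a time: adding [q] to [l] divides
   [F_m / fib_lcm l m] by the same quotient at [m / q]. Since
   [F_a F_b <= F_(a+b) <= 3 F_a F_b], the error factor [K] becomes [3 K^2]. *)
Lemma fib_lcm_bounds l m0 (K := 3 ^ (2 ^ size l).-1)
    (m := m0 * \prod_(q <- l) q) (X := m0 * \prod_(q <- l) q.-1) :
  0 < m0 -> uniq l -> all prime l ->
  fib m <= K * (fib X * fib_lcm l m) /\ fib X * fib_lcm l m <= K * fib m.
Proof.
rewrite {}/K {}/m {}/X.
elim: l m0 => [|q l IH] m0 m0_gt0.
  by rewrite /fib_lcm !big_nil !muln1 mul1n.
move=> /= /andP[q_l l_uniq] /andP[q_pr l_pr]; rewrite !big_cons.
set P := \prod_(j <- l) j; set Y := \prod_(j <- l) j.-1.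
have q_gt1 := prime_gt1 q_pr.
have [IH1 IH1'] := IH (m0 * q) ltac:(nia) l_uniq l_pr.
have [IH2 IH2'] := IH m0 m0_gt0 l_uniq l_pr.
rewrite -/P -/Y -!mulnA in IH1 IH1' IH2 IH2'.
set m := m0 * (q * P) in IH1 IH1' *.
have Em : m %/ q = m0 * P by rewrite /m mulnCA mulKn // ltnW.
have P_gt0 : 0 < P.
  rewrite /P big_seq_cond; apply: prodn_cond_gt0 => i; rewrite andbT => il.
  exact/prime_gt0/(allP l_pr).
have Y_gt0 : 0 < Y.
  rewrite /Y big_seq_cond; apply: prodn_cond_gt0 => i; rewrite andbT => il.
  by have := prime_gt1 (allP l_pr i il); case: i {il} => [|[]].
have m_gt0 : 0 < m by rewrite /m !muln_gt0 m0_gt0 P_gt0 ltnW.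
have l_m : all (fun r => r %| m) l.
  by apply/allP => r rl; rewrite /m !dvdn_mull // /P (big_rem r) //= dvdn_mulr.
have q_m : q %| m by rewrite /m mulnCA dvdn_mulr.
(* This is lcm(u, v) gcd(u, v) = u v with u = F_(m/q) and v = [fib_lcm l m]. *)
have E : fib_lcm (q :: l) m * fib_lcm l (m0 * P) = fib (m0 * P) * fib_lcm l m.
  rewrite -Em -(gcdn_fib_lcm_cons q l m) // /fib_lcm big_cons muln_lcm_gcd //.
set A' := fib_lcm (q :: l) m in E *; set A := fib_lcm l m in E IH1 IH1' *.
set B := fib_lcm l (m0 * P) in E IH2 IH2' *.
have B_gt0 : 0 < B.
  apply: fib_lcm_gt0; first by rewrite muln_gt0 m0_gt0.
  apply/allP => r rl; rewrite prime_gt0 ?(allP l_pr) //=.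
  by rewrite dvdn_mull // /P (big_rem r) //= dvdn_mulr.
have -> : 3 ^ (2 ^ (size l).+1).-1 = 3 * 3 ^ (2 ^ size l).-1 * 3 ^ (2 ^ size l).-1.
  rewrite -mulnA -expnD -expnS; congr (_ ^ _).
  by have := expn_gt0 2 (size l); rewrite expnS /=; lia.
set K := 3 ^ _ in IH1 IH1' IH2 IH2' *.
(* The indices for [l] at m and at m/q differ by the index for [q :: l] at m, so F at the latter is
   nearly a quotient of the other two values. *)
have XE : m0 * (q * Y) = m0 * (q.-1 * Y) + m0 * Y.
  by case: (q) q_gt1 => // q' _; rewrite mulSn mulnDr addnC.
have XY_gt0 : 0 < m0 * (q.-1 * Y) by rewrite !muln_gt0 m0_gt0 Y_gt0; case: (q) q_gt1 => [|[]].
have mY_gt0 : 0 < m0 * Y by rewrite muln_gt0 m0_gt0.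
have F1 := fib_add_ge (m0 * (q.-1 * Y)) (m0 * Y).
have F2 := fib_add_le _ _ XY_gt0 mY_gt0.
rewrite -XE in F1 F2.
move: (fib m) (fib (m0 * P)) (fib (m0 * (q * Y))) (fib (m0 * (q.-1 * Y)))
  (fib (m0 * Y)) => fm fmP fqY fX fY in IH1 IH1' IH2 IH2' E F1 F2 *.
split; rewrite -(leq_pmul2r B_gt0).
  apply: (@leq_trans (K * (3 * (fX * fY) * A) * B)).
    by rewrite leq_mul2r (leq_trans IH1) ?orbT // leq_mul2l leq_mul2r F2 !orbT.
  have -> : K * (3 * (fX * fY) * A) * B = 3 * K * fX * A * (fY * B) by ring.
  apply: leq_trans (leq_mul (leqnn _) IH2') _.
  have -> : 3 * K * K * (fX * A') * B = 3 * K * K * fX * (A' * B) by ring.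
  by rewrite E; apply: eq_leq; ring.
have -> : fX * A' * B = fX * (A' * B) by ring.
rewrite E; apply: (@leq_trans (K * (fX * fY) * (A * B))).
  have -> : K * (fX * fY) * (A * B) = fX * (K * (fY * B)) * A by ring.
  have -> : fX * (fmP * A) = fX * fmP * A by ring.
  by rewrite leq_mul2r leq_mul2l IH2 !orbT.
apply: (@leq_trans (K * (fqY * A) * B)).
  have -> : K * (fX * fY) * (A * B) = K * (fX * fY * A) * B by ring.
  by rewrite leq_mul2r leq_mul2l leq_mul2r F1 !orbT.
rewrite leq_mul2r; apply/orP; right.
apply: leq_trans (leq_mul (leqnn K) IH1') _.
by rewrite mulnA -mulnA -[3 * K * K * fm]mulnA -[3 * K * _]mulnA leq_pmull // mulnA.
Qed.

(** * Numerical estimates and primitive prime divisors *)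

(** From z to z+1 the left side grows at most by the factor 2 * 3 = 6, the right side at least by
    F_(2z+1) >= F_11 = 89. At z = 5, 14580 < 144 * 233 <= F_25. *)
Lemma fib_sqr_gt z : 5 <= z -> z * 3 ^ z.-1 * z.+1 ^ 2 < fib (z ^ 2).
Proof.
move=> /subnKC <-; elim: (z - 5) => [|k IH].
  apply: leq_trans (fib_add_ge 12 13).
  have [-> ->] : fib 12 = 144 /\ fib 13 = 233 by [].
  by rewrite addn0 !expnS !expn0; lia.
rewrite addnS; move: (5 + k) (leq_addr k 5) IH => n n_ge5 IH.
have -> : n.+1 ^ 2 = n ^ 2 + n.*2.+1 by rewrite -addn1 sqrnD; lia.
apply: leq_trans (fib_add_ge _ _).
apply: leq_trans (leq_mul IH (leq_fib 11 n.*2.+1 ltac:(lia))).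
have -> : fib 11 = 89 by [].
case: n n_ge5 {IH} => // n n_ge5; rewrite /= [3 ^ n.+1]expnS.
move: (3 ^ n) => t.
have le_a : n.+2 * n.+3 ^ 2 <= 2 * (n.+1 * n.+2 ^ 2) by rewrite !expnS !expn0; nia.
have := leq_mul le_a (leqnn (3 * t)); nia.
Qed.

(** For X >= 25, apply [fib_sqr_gt] to the integer square root of X. For 20 <= X < 25, z is at most
    4 and 4 * 27 * 24 < 55^2 <= F_20. *)
Lemma fib_gt_mul z X : z ^ 2 <= X -> 20 <= X -> z * 3 ^ z.-1 * X < fib X.
Proof.
move=> le_zX X_ge; have [X_ge25|X_lt25] := leqP 25 X.
  have [y [y_ge5 y_X X_y]] : exists y, [/\ 5 <= y, y ^ 2 <= X & X < y.+1 ^ 2].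
    have ex : exists y, y ^ 2 <= X by exists 0.
    have bd y : y ^ 2 <= X -> y <= X by apply: leq_trans; rewrite expnS expn1; nia.
    case: (ex_maxnP ex bd) => y y_X y_max; exists y; split=> //; first exact: y_max.
    by rewrite ltnNge; apply/negP => /y_max; rewrite ltnn.
  have le_zy : z <= y.
    by rewrite -ltnS -(ltn_exp2r _ _ (isT : 0 < 2)); apply: leq_ltn_trans X_y.
  apply: leq_trans (leq_fib _ _ y_X); apply: leq_trans (fib_sqr_gt y y_ge5).
  rewrite ltnS leq_mul ?(ltnW X_y) // leq_mul // leq_pexp2l //; lia.
have z_le4 : z <= 4.
  by rewrite -ltnS -(ltn_exp2r _ _ (isT : 0 < 2)); apply: leq_ltn_trans le_zX _.
apply: leq_trans (leq_fib _ _ X_ge); apply: leq_trans (fib_add_ge 10 10).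
have -> : fib 10 = 55 by [].
apply: (@leq_ltn_trans (4 * 3 ^ 3 * 24)); last by rewrite !expnS expn0; lia.
by rewrite leq_mul // leq_mul // leq_pexp2l //; lia.
Qed.

Lemma prod_primes_dvd l n :
  uniq l -> all prime l -> all (fun q => q %| n) l -> \prod_(q <- l) q %| n.
Proof.
elim: l => [|q l IH] /=; first by rewrite big_nil dvd1n.
move=> /andP[q_l l_uniq] /andP[q_pr l_pr] /andP[q_n l_n].
rewrite big_cons Gauss_dvd ?q_n ?IH // big_seq.
elim/big_ind: _ => [|a b qa qb|r rl]; rewrite ?coprimen1 ?coprimeMr ?qa //.
rewrite prime_coprime // dvdn_prime2 ?(allP l_pr r rl) //.
by apply: contraNneq q_l => ->.
Qed.

(** With z = 2^(size l) and X as in [fib_lcm_bounds], these give z^2 <= X and d <= z X. *)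
Lemma prod_pred_bounds l : all (fun q => 5 <= q) l ->
  [/\ 4 ^ size l <= \prod_(q <- l) q.-1
    & \prod_(q <- l) q <= 2 ^ size l * \prod_(q <- l) q.-1].
Proof.
elim: l => [|q l IH] /=; first by rewrite !big_nil.
case/andP=> q_ge5 /IH[IH1 IH2]; rewrite !big_cons !expnS; split.
  by rewrite leq_mul //; lia.
rewrite mulnACA leq_mul //; lia.
Qed.

(* A case of Carmichael's theorem. *)
Lemma primitive_prime d : 1 < d -> coprime d 6 ->
  exists2 p, prime p & fib_rank p d.
Proof.
move=> d_gt1 d6; have d_gt0 := ltnW d_gt1.
have d_odd : odd d by move: d6; rewrite (coprimeMr d 2 3) coprimen2 => /andP[].
have dvd_ge5 q : 1 < q -> q %| d -> 5 <= q.
  move=> q_gt1 q_d; have := coprime_dvdl q_d d6.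
  by case: q q_gt1 {q_d} => [|[|[|[|[|?]]]]].
have d_ge5 := dvd_ge5 d d_gt1 (dvdnn d).
have Fd_gt1 : 1 < fib d by apply: leq_trans (leq_fib _ _ d_ge5).
(* A prime d is treated apart, since X = d - 1 may be too small for the estimates. The rank of a
   prime dividing F_d is then 1 or d, and F_1 = 1 excludes 1. *)
have [d_pr|d_npr] := boolP (prime d).
  exists (pdiv (fib d)); first exact: pdiv_prime.
  have [r rk r_d] := fib_rank_ex _ _ d_gt0 (pdiv_dvd (fib d)).
  have /primeP[_ /(_ r r_d) /orP[/eqP r1|/eqP r_eq]] := d_pr; last by rewrite -{2}r_eq.
  by case: rk => _; rewrite r1 dvdn1 => /eqP p1; have := pdiv_prime Fd_gt1; rewrite p1.
have [ex|nex] := boolP (has (fun p => [forall m : 'I_d, (0 < m) ==> ~~ (p %| fib m)])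
   (primes (fib d))).
  case/hasP: ex => p; rewrite mem_primes => /and3P[p_pr _ p_d] /forallP p_min.
  exists p => //; split=> // m m_gt0 lt_m.
  by have := p_min (Ordinal lt_m); rewrite m_gt0.
have no_prim p : prime p -> p %| fib d -> ~ fib_rank p d.
  move=> p_pr p_d [_ _ p_min]; move/negP: nex; apply; apply/hasP; exists p.
    by rewrite mem_primes p_pr p_d fib_gt0.
  by apply/forallP => m; apply/implyP => m_gt0; apply: p_min.
pose l := primes d.
have l_pr : all prime l by apply/allP => q; rewrite mem_primes => /andP[].
have l_d : all (fun q => q %| d) l.
  by apply/allP => q; rewrite mem_primes => /and3P[].
have l_ge5 : all (fun q => 5 <= q) l.
  apply/allP => q ql; apply: dvd_ge5; last exact: (allP l_d).
  exact/prime_gt1/(allP l_pr).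
have l_uniq : uniq l := primes_uniq d.
have P_d := prod_primes_dvd l d l_uniq l_pr l_d.
pose m0 := d %/ \prod_(q <- l) q.
have dE : d = m0 * \prod_(q <- l) q by rewrite divnK.
have m0_gt0 : 0 < m0 by move: d_gt0; rewrite dE muln_gt0 => /andP[].
have [_] := fib_lcm_bounds l m0 m0_gt0 l_uniq l_pr; rewrite -dE.
have [Y_ge PY] := prod_pred_bounds l l_ge5.
have A_gt0 : 0 < fib_lcm l d.
  apply: fib_lcm_gt0 => //; apply/allP => q ql.
  by rewrite (allP l_d q ql) prime_gt0 // (allP l_pr).
have : fib d <= d * fib_lcm l d.
  by apply: dvdn_leq (fib_dvd_lcm d d_gt0 d_odd no_prim); rewrite muln_gt0 d_gt0.
set A := fib_lcm l d in A_gt0 *; set z := 2 ^ size l; set X := m0 * _ => FA XA.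
(* Since d is composite and prime to 6, either it has one prime divisor and m0 >= 5, or two distinct
   ones, which contribute at least 4 * 5. *)
have X_ge : 20 <= X.
  rewrite /X; move: l_ge5 dE {PY Y_ge X z XA FA A A_gt0 P_d l_d}.
  have : 0 < size l by rewrite -has_predT; apply/hasP; exists (pdiv d); rewrite // pi_pdiv.
  move: l m0 l_uniq l_pr m0_gt0 => [|q [|r l']] //= m0 l'_uniq l'_pr m0_gt0 _.
    rewrite !big_cons !big_nil !muln1 => /andP[q_ge5 _] dE.
    have m0_ge5 : 5 <= m0.
      apply: dvd_ge5; last by rewrite dE dvdn_mulr.
      rewrite ltn_neqAle m0_gt0 andbT; apply: contraNneq d_npr => m0_1.
      by move: l'_pr; rewrite dE -m0_1 mul1n andbT.
    have : 4 <= q.-1 by lia.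
    by move/(leq_mul m0_ge5).
  case/and3P=> q_ge5 r_ge5 /prod_pred_bounds[Y'_ge _] _.
  have q_r : q != r by apply: contraTneq l'_uniq => ->; rewrite inE eqxx.
  rewrite !big_cons.
  have qr20 : 20 <= q.-1 * r.-1.
    have [lt_qr|lt_rq|] := ltngtP q r; last by move/eqP: q_r.
      by apply: (@leq_mul 4 5); lia.
    by apply: (@leq_mul 5 4); lia.
  have Y'_gt0 : 0 < \prod_(j <- l') j.-1 by apply: leq_trans Y'_ge; rewrite expn_gt0.
  rewrite mulnA; nia.
have zX : z ^ 2 <= X.
  rewrite -expnM mulnC expnM; apply: leq_trans Y_ge _.
  by rewrite leq_pmull.
have dX : d <= z * X by rewrite dE /X mulnCA leq_mul2l PY orbT.
(* The contradiction: z 3^(z-1) X < F_X <= 3^(z-1) d <= 3^(z-1) z X. *)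
have := fib_gt_mul z X zX X_ge; rewrite ltnNge => /negP[].
have : fib X <= 3 ^ z.-1 * d.
  rewrite -(leq_pmul2r A_gt0); apply: leq_trans XA _.
  by rewrite -mulnA leq_mul2l FA orbT.
move=> H; apply: leq_trans H _.
by rewrite [z * _]mulnC -mulnA leq_mul2l dX orbT.
Qed.

Lemma good_prime d : 2 < d ->
  exists p r D, [/\ prime p, fib_rank p r, d = D * r &
    D = 1 \/ fib r.+1 ^ r = 1 %[mod p]].
Proof.
move=> d_gt2; have d_gt0 : 0 < d by lia.
have [d6|] := boolP (coprime d 6).
  have [p p_pr rk] := primitive_prime d (ltnW d_gt2) d6.
  by exists p, d, 1; split=> //; [rewrite mul1n | left].
rewrite (coprimeMr d 2 3) negb_and coprimen2 => /orP[d_even | d3].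
  have [|p [r [p_pr rk r_d c1]]] := even_rank_prime d./2.
    by rewrite -ltn_double even_halfK.
  rewrite even_halfK // in r_d.
  by exists p, r, (d %/ r); split=> //; [rewrite divnK | right].
(* The prime 2 has rank 3, and F_4 = 3 is odd. *)
exists 2, 3, (d %/ 3); split=> //; last by right.
  by split=> // -[|[|[|m]]].
by rewrite divnK //; move: d3; rewrite coprime_sym prime_coprime // negbK.
Qed.

Local Open Scope ring_scope.

(** * From residues modulo p back to the rationals *)

(** Both determinants, over F_p and over the rationals, are images of one integer, which is nonzero
    as soon as its residue is. *)
Lemma det_natr (K : comNzRingType) (d : nat) (f : nat -> nat -> nat) :
  \det (\matrix_(i < d, j < d) (f i j)%:R) =
  (\det (\matrix_(i < d, j < d) (f i j)%:R : 'M[int]_d))%:~R :> K.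
Proof.
rewrite -[RHS](det_map_mx intr); congr (\det _).
by apply/matrixP => i j; rewrite !mxE rmorph_nat.
Qed.

Lemma det_fibbin_rat_neq0 (d n : nat) : (0 < d)%N -> ~ (n = 0%N /\ d = 2%N) ->
  \det (\matrix_(i < d, j < d) (fibbin (n + i + j) j)%:R) != 0 :> rat.
Proof.
move=> d_gt0 den_ok; have [d_gt2|] := ltnP 2 d; last first.
  (* F_1 = F_2 = 1 have no prime divisors, so d <= 2 is computed: the determinant is 1 for d = 1 and
     F_(n+2) - F_(n+1) = F_n for d = 2. *)
  case: d d_gt0 den_ok => [|[|[|]]] // _ den_ok _.
    by rewrite det_mx11 mxE fibbin0 oner_eq0.
  rewrite (expand_det_row _ ord0) !big_ord_recl big_ord0 /cofactor !det_mx11 !mxE.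
  rewrite /= !fibbin0.
  have fibbin1 m : fibbin (m + 1) 1 = fib m.+1.
    by rewrite addn1 fibbinSS subn0 fibbin0 muln1 mul0n addn0.
  have -> : bump 0 0 = 1%N by [].
  rewrite !fibbin1 !addn0 !addn1 fibSS natrD expr0 expr1.
  have -> (x y : rat) : 1 * (1 * (x + y)) + (x * (-1 * 1) + 0) = y by ring.
  rewrite Num.Theory.pnatr_eq0 -lt0n fib_gt0 // lt0n; apply/eqP => n0; exact: den_ok.
have [p [r [D [p_pr rk -> hD]]]] := good_prime d d_gt2.
have pFp : p \in [pchar 'F_p] := pchar_Fp p_pr.
have hD' : D = 1%N \/ (fib r.+1)%:R ^+ r = 1 :> 'F_p.
  case: hD => [|c1]; [by left | right].
  by rewrite -natrX -(Fp_nat_mod p_pr) c1 (Fp_nat_mod p_pr).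
have := det_fibbin_neq0 _ p r D n pFp rk hD'.
rewrite (det_natr _ _ (fun i j => fibbin (n + i + j) j)).
rewrite (det_natr rat _ (fun i j => fibbin (n + i + j) j)).
by rewrite intr_eq0; apply: contraNneq => ->; rewrite mulr0z.
Qed.

(** * Both sides as products of Fibonacci factorials *)

Lemma fibfact_neq0 m : (fibfact m)%:R != 0 :> rat.
Proof. by rewrite Num.Theory.pnatr_eq0 -lt0n fibfact_gt0. Qed.

Lemma prod_fib_desc m k :
  \prod_(j < k) (fib (m + k - j))%:R = (fibfact (m + k))%:R / (fibfact m)%:R :> rat.
Proof.
elim: k => [|k IH]; first by rewrite big_ord0 addn0 divff ?fibfact_neq0.
rewrite big_ord_recl subn0 addnS.
under eq_bigr do rewrite lift0 subSS.
by rewrite IH fibfactS natrM mulrCA mulrA.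
Qed.

Lemma fibonomial_fact m k :
  fibonomial (m + k) k = (fibfact (m + k))%:R / ((fibfact k)%:R * (fibfact m)%:R).
Proof.
rewrite /fibonomial leq_addl prodf_div prod_fib_desc.
have -> : \prod_(j < k) (fib (k - j))%:R = (fibfact k)%:R :> rat.
  apply: etrans (prod_fib_desc 0 k) _.
  by rewrite add0n [X in _ / X%:R]/fibfact big_ord0 divr1.
by rewrite invfM mulrA mulrAC.
Qed.

Lemma fibonomialE m k : fibonomial (m + k) k = (fibbin (m + k) k)%:R.
Proof.
rewrite fibonomial_fact -fibbin_fact !natrM -mulrA divff ?mulr1 //.
by rewrite mulf_neq0 ?fibfact_neq0.
Qed.

Lemma det_fibonomial d n k :
  (k <= n)%N ->
  \det (\matrix_(i < d, j < d) fibonomial (n + i + j) (k + j)) =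
    \det (\matrix_(i < d, j < d) (fibfact (n + i + j))%:R) *
    \prod_(i < d) ((fibfact (k + i))%:R * (fibfact (n - k + i))%:R)^-1.
Proof.
move=> le_kn.
have -> : \matrix_(i < d, j < d) fibonomial (n + i + j) (k + j) =
  diag_mx (\row_(i < d) (fibfact (n - k + i))%:R^-1) *m
  (\matrix_(i < d, j < d) (fibfact (n + i + j))%:R) *m
  diag_mx (\row_(i < d) (fibfact (k + i))%:R^-1).
  apply/matrixP => i j; rewrite mul_mx_diag mul_diag_mx !mxE.
  have -> : (n + i + j = (n - k + i) + (k + j))%N by lia.
  by rewrite fibonomial_fact invfM; ring.
rewrite !det_mulmx !det_diag.
rewrite mulrC mulrA -big_split mulrC /=; congr (_ * _).
by apply: eq_bigr => i _; rewrite !mxE invfM.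
Qed.

Lemma fibo_hoggattE d m : (0 < d)%N ->
  fibo_hoggatt d m.+1 = (\prod_(i < d) (fib (m.+1 + i))%:R) / (fibfact d)%:R.
Proof.
move=> d_gt0; rewrite /fibo_hoggatt addSn subn1 -pred_Sn fibonomial_fact.
rewrite invfM mulrA mulrAC -prod_fib_desc; congr (_ / _).
rewrite (reindex_inj rev_ord_inj); apply: eq_bigr => i _; congr (fib _)%:R.
by rewrite /=; have := ltn_ord i; lia.
Qed.

(** Each Fibo-Hoggatt number is a product of d consecutive Fibonacci numbers over [d]!, which
    cancels. After exchanging the products, the factors for fixed i are again consecutive. *)
Lemma fibo_hoggatt_coefE d n k : (0 < d)%N -> (k <= n)%N ->
  fibo_hoggatt_coef d n k =
    \prod_(i < d) ((fibfact (n + i))%:R * (fibfact i)%:R /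
                   ((fibfact (k + i))%:R * (fibfact (n - k + i))%:R)).
Proof.
move=> d_gt0 le_kn; rewrite /fibo_hoggatt_coef.
transitivity (\prod_(j < k) \prod_(i < d)
    ((fib (n + i - j))%:R / (fib (k + i - j))%:R) : rat).
  apply: eq_bigr => j _; have lt_jk := ltn_ord j.
  have -> : (n - j = (n - j).-1.+1)%N by lia.
  have -> : (k - j = (k - j).-1.+1)%N by lia.
  rewrite !fibo_hoggattE // prodf_div -mulf_div invrK mulVf ?fibfact_neq0 // mulr1.
  by congr (_ / _); apply: eq_bigr => i _; congr (fib _)%:R; lia.
rewrite exchange_big; apply: eq_bigr => i _; rewrite prodf_div /=.
have E m : (k <= m)%N -> \prod_(j < k) (fib (m + i - j))%:R =
    (fibfact (m + i))%:R / (fibfact (m - k + i))%:R :> rat.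
  move=> le_km; have {1 2}-> : (m + i = (m - k + i) + k)%N by lia.
  exact: prod_fib_desc.
rewrite !E // subnn add0n invf_div mulf_div; congr (_ / _); exact: mulrC.
Qed.

Theorem theorem11 (d n k : nat) (d_gt0 : (0 < d)%N) (le_kn : (k <= n)%N)
    (den_ok : ~ (n = 0%N /\ d = 2%N)) :
  fibo_hoggatt_coef d n k =
    \det (\matrix_(i < d, j < d) fibonomial (n + i + j) (k + j)) /
    \det (\matrix_(i < d, j < d) fibonomial (n + i + j) j).
Proof.
have den_neq0 : \det (\matrix_(i < d, j < d) fibonomial (n + i + j) j) != 0.
  have := det_fibbin_rat_neq0 d n d_gt0 den_ok; apply: contraNneq => <-.
  by apply/eqP; congr (\det _); apply/matrixP => i j; rewrite !mxE fibonomialE.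
(* The denominator is the case k = 0 of the numerator, so the common Hankel determinant is nonzero
   and cancels. *)
have den := det_fibonomial d n 0 isT; rewrite den in den_neq0 *.
move: den_neq0; rewrite mulf_eq0 negb_or => /andP[H_neq0 _].
rewrite fibo_hoggatt_coefE // det_fibonomial // -mulf_div divff // mul1r -prodf_div.
apply: eq_bigr => i _; rewrite subn0 add0n invrK.
by rewrite mulrC [(fibfact i)%:R * _]mulrC.
Qed.
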